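(* Let $\mathbb C$ be a protomodular category which is locally algebraically cartesian closed. Then $\mathbb C$ is strongly protomodular.
   Context: For a finitely complete category $\mathbb C$ and an object $Y$, $Pt_Y\mathbb C$ has as objects the pairs $(f:X\to Y,\ s:Y\to X)$ with $fs=1_Y$, and as morphisms the maps over $Y$ commuting with the sections. For $h:X\to Y$, $h^*:Pt_Y\mathbb C\to Pt_X\mathbb C$ is the change of base functor given by pulling back along $h$. $\mathbb C$ is protomodular when every $h^*$ is conservative (reflects isomorphisms). $\mathbb C$ is locally algebraically cartesian closed when every $h^*$ has a right adjoint. A monomorphism $m:X'\rightarrowtail X$ is normal to an equivalence relation $R$ on $X$ when there is a morphism of equivalence relations from the indiscrete relation $\nabla_{X'}=X'\times X'$ on $X'$ to $R$, with underlying map $m$, which is a discrete fibration (the squares with the projections are pullbacks); $m$ is normal when it is normal to some equivalence relation. A left exact functor is normal when it is conservative and reflects normal monomorphisms. A protomodular category $\mathbb C$ is strongly protomodular when every change of base functor $h^*:Pt_Y\mathbb C\to Pt_X\mathbb C$ is normal. *)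

(* Defs.v *)
From Stdlib Require Import List ProofIrrelevance ClassicalEpsilon.

Set Implicit Arguments.
Unset Strict Implicit.
Unset Printing Implicit Defensive.

Record Category : Type := {
  Ob :> Type;
  Hom : Ob -> Ob -> Type;
  idm : forall A, Hom A A;
  comp : forall A B D, Hom B D -> Hom A B -> Hom A D;
  comp_id_l : forall A B (f : Hom A B), comp (idm B) f = f;
  comp_id_r : forall A B (f : Hom A B), comp f (idm A) = f;
  comp_assoc : forall A B D E (h : Hom D E) (g : Hom B D) (f : Hom A B),
    comp h (comp g f) = comp (comp h g) f
}.

Arguments Hom {c} _ _.
Arguments idm {c} A.
Arguments comp {c A B D} _ _.

Declare Scope cat_scope.
Delimit Scope cat_scope with cat.
Local Open Scope cat_scope.
Notation "g ∘ f" := (comp g f) (at level 40, left associativity) : cat_scope.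

Definition monic {C : Category} {A B : C} (m : Hom A B) : Prop :=
  forall (T : C) (u v : Hom T A), m ∘ u = m ∘ v -> u = v.

Definition iso {C : Category} {A B : C} (f : Hom A B) : Prop :=
  exists g : Hom B A, g ∘ f = idm A /\ f ∘ g = idm B.

Record Functor (C D : Category) : Type := {
  fobj :> C -> D;
  fmap : forall A B : C, Hom A B -> Hom (fobj A) (fobj B);
  fmap_id : forall A : C, fmap (idm A) = idm (fobj A);
  fmap_comp : forall (A B E : C) (g : Hom B E) (f : Hom A B),
    fmap (g ∘ f) = fmap g ∘ fmap f
}.

Arguments fmap {C D} f {A B} _ : rename.

Definition functor_comp (C D E : Category) (G : Functor D E) (F : Functor C D) :
  Functor C E.
Proof.
refine {| fobj := fun A => G (F A); fmap := fun A B f => fmap G (fmap F f) |}.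
- intros A; now rewrite !fmap_id.
- intros A B K g f; now rewrite !fmap_comp.
Defined.

(** Unit-counit presentation of [F -| G]. *)
Record Adjunction (C D : Category) (F : Functor C D) (G : Functor D C) : Type := {
  adj_unit : forall A : C, Hom A (G (F A));
  adj_counit : forall B : D, Hom (F (G B)) B;
  adj_unit_natural : forall (A A' : C) (f : Hom A A'),
    adj_unit A' ∘ f = fmap G (fmap F f) ∘ adj_unit A;
  adj_counit_natural : forall (B B' : D) (g : Hom B B'),
    g ∘ adj_counit B = adj_counit B' ∘ fmap F (fmap G g);
  adj_triangle_l : forall A : C, adj_counit (F A) ∘ fmap F (adj_unit A) = idm (F A);
  adj_triangle_r : forall B : D, fmap G (adj_counit B) ∘ adj_unit (G B) = idm (G B)
}.

Definition has_right_adjoint (C D : Category) (F : Functor C D) : Prop :=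
  exists G : Functor D C, inhabited (Adjunction F G).

(** * Finite limits *)

Record Cone (J C : Category) (D : Functor J C) : Type := {
  apex : C;
  leg : forall j : J, Hom apex (D j);
  leg_natural : forall (i j : J) (a : Hom i j), fmap D a ∘ leg i = leg j
}.

Arguments leg {J C D} _ _.

Definition is_limit (J C : Category) (D : Functor J C) (c : Cone D) : Prop :=
  forall c' : Cone D,
    exists! u : Hom (apex c') (apex c), forall j : J, leg c j ∘ u = leg c' j.

Definition map_cone (J C E : Category) (D : Functor J C) (F : Functor C E)
  (c : Cone D) : Cone (functor_comp F D).
Proof.
refine (@Build_Cone J E (functor_comp F D) (F (apex c))
          (fun j => fmap F (leg c j)) _).
intros i j a; simpl; rewrite <- fmap_comp; now rewrite leg_natural.
Defined.

Definition finite_type (T : Type) : Prop := exists l : list T, forall x, In x l.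

Definition finite_category (J : Category) : Prop :=
  finite_type J /\ forall i j : J, finite_type (Hom i j).

(** Limits are chosen, so that pulling back is an actual functor. *)
Record FinitelyComplete (C : Category) : Type := {
  lim : forall (J : Category) (D : Functor J C), finite_category J -> Cone D;
  lim_is_limit : forall (J : Category) (D : Functor J C) (fJ : finite_category J),
    is_limit (lim D fJ)
}.

Definition left_exact (C E : Category) (F : Functor C E) : Prop :=
  forall (J : Category) (D : Functor J C), finite_category J ->
  forall c : Cone D, is_limit c -> is_limit (map_cone F c).

(** * Products and pullbacks *)

Definition is_product {C : Category} {A B P : C}
  (p : Hom P A) (q : Hom P B) : Prop :=
  forall (T : C) (a : Hom T A) (b : Hom T B),
    exists! u : Hom T P, p ∘ u = a /\ q ∘ u = b.

(** <<
      P --q--> B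
      |        |
      p        g
      v        v
      A --f--> D
    >> *)
Definition is_pullback {C : Category} {A B D P : C}
  (f : Hom A D) (g : Hom B D) (p : Hom P A) (q : Hom P B) : Prop :=
  f ∘ p = g ∘ q /\
  forall (T : C) (a : Hom T A) (b : Hom T B), f ∘ a = g ∘ b ->
    exists! u : Hom T P, p ∘ u = a /\ q ∘ u = b.

Inductive cospan_ob : Set := c_left | c_right | c_base.

Definition cospan_hom (i j : cospan_ob) : Set :=
  match i, j with
  | c_left, c_left | c_right, c_right | c_base, c_base
  | c_left, c_base | c_right, c_base => unit
  | _, _ => Empty_set
  end.

Definition cospan_id (i : cospan_ob) : cospan_hom i i :=
  match i with c_left | c_right | c_base => tt end.

Definition cospan_comp (i j k : cospan_ob) :
  cospan_hom j k -> cospan_hom i j -> cospan_hom i k.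
Proof.
destruct i, j, k; simpl; intros b a; first [exact tt | now destruct a | now destruct b].
Defined.

Definition cospan : Category.
Proof.
refine {| Ob := cospan_ob; Hom := cospan_hom;
          idm := cospan_id; comp := cospan_comp |}.
- now intros [] [] [].
- now intros [] [] [].
- now intros [] [] [] [] [] [] [].
Defined.

Lemma cospan_finite : finite_category cospan.
Proof.
split.
- exists (c_left :: c_right :: c_base :: nil); intros []; simpl; tauto.
- intros [] []; simpl;
    first [ now exists (tt :: nil); intros []; left | now exists nil; intros [] ].
Qed.

Definition cospan_functor {C : Category} {A B D : C} (f : Hom A D) (g : Hom B D) :
  Functor cospan C.
Proof.
refine (@Build_Functor cospan C
  (fun i => match i with c_left => A | c_right => B | c_base => D end)
  (fun i j => match i, j with
    | c_left, c_left => fun _ => idm A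
    | c_right, c_right => fun _ => idm B
    | c_base, c_base => fun _ => idm D
    | c_left, c_base => fun _ => f
    | c_right, c_base => fun _ => g
    | _, _ => fun a => ltac:(destruct a)
    end) _ _).
- now intros [].
- intros [] [] [] [] []; simpl; now rewrite ?comp_id_l, ?comp_id_r.
Defined.

Section Pullback.
Variables (C : Category) (L : FinitelyComplete C).
Variables (A B D : C) (f : Hom A D) (g : Hom B D).

Definition pb_cone : Cone (cospan_functor f g) :=
  lim L (cospan_functor f g) cospan_finite.

Definition pb : C := apex pb_cone.
Definition pb_fst : Hom pb A := leg pb_cone c_left.
Definition pb_snd : Hom pb B := leg pb_cone c_right.

Lemma pb_is_pullback : is_pullback f g pb_fst pb_snd.
Proof.
assert (Hf : f ∘ pb_fst = leg pb_cone c_base)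
  by exact (@leg_natural _ _ _ pb_cone c_left c_base tt).
assert (Hg : g ∘ pb_snd = leg pb_cone c_base)
  by exact (@leg_natural _ _ _ pb_cone c_right c_base tt).
split; [now rewrite Hf, Hg |].
intros T a b e.
assert (nat : forall (i j : cospan) (x : Hom i j),
  fmap (cospan_functor f g) x ∘
    (match i return Hom T (cospan_functor f g i) with
     | c_left => a | c_right => b | c_base => f ∘ a end) =
    (match j return Hom T (cospan_functor f g j) with
     | c_left => a | c_right => b | c_base => f ∘ a end)).
{ intros [] [] []; simpl; rewrite ?comp_id_l; auto. }
destruct (@lim_is_limit C L cospan (cospan_functor f g) cospan_finite
            (Build_Cone nat)) as [u [Hu Uu]].
exists u; split.
- split; [exact (Hu c_left) | exact (Hu c_right)].
- intros v [Ha Hb]; apply Uu; intros []; simpl; [exact Ha | exact Hb |].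
  change (leg pb_cone c_base ∘ v = f ∘ a).
  now rewrite <- Hf, <- comp_assoc, Ha.
Qed.

Definition pb_lift (T : C) (a : Hom T A) (b : Hom T B) (e : f ∘ a = g ∘ b) :
  Hom T pb :=
  proj1_sig (constructive_definite_description _ (proj2 pb_is_pullback T a b e)).

Lemma pb_lift_fst (T : C) (a : Hom T A) (b : Hom T B) (e : f ∘ a = g ∘ b) :
  pb_fst ∘ pb_lift e = a.
Proof. unfold pb_lift; now destruct constructive_definite_description. Qed.

Lemma pb_lift_snd (T : C) (a : Hom T A) (b : Hom T B) (e : f ∘ a = g ∘ b) :
  pb_snd ∘ pb_lift e = b.
Proof. unfold pb_lift; now destruct constructive_definite_description. Qed.

Lemma pb_comm : f ∘ pb_fst = g ∘ pb_snd.
Proof. exact (proj1 pb_is_pullback). Qed.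

Lemma pb_ext (T : C) (u v : Hom T pb) :
  pb_fst ∘ u = pb_fst ∘ v -> pb_snd ∘ u = pb_snd ∘ v -> u = v.
Proof.
intros E1 E2.
assert (e : f ∘ (pb_fst ∘ v) = g ∘ (pb_snd ∘ v))
  by now rewrite !comp_assoc, pb_comm.
destruct (proj2 pb_is_pullback T _ _ e) as [w [_ Hw]].
now rewrite <- (Hw u), <- (Hw v) by auto.
Qed.

End Pullback.

(** * Points *)

Record Point (C : Category) (Y : C) : Type := {
  pt_dom : C;
  pt_map : Hom pt_dom Y;
  pt_sec : Hom Y pt_dom;
  pt_split : pt_map ∘ pt_sec = idm Y
}.

Record PointHom (C : Category) (Y : C) (P Q : Point Y) : Type := {
  ph_map : Hom (pt_dom P) (pt_dom Q);
  ph_over : pt_map Q ∘ ph_map = pt_map P;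
  ph_sec : ph_map ∘ pt_sec P = pt_sec Q
}.

Lemma PointHom_ext (C : Category) (Y : C) (P Q : Point Y) (u v : PointHom P Q) :
  ph_map u = ph_map v -> u = v.
Proof.
destruct u as [u u1 u2], v as [v v1 v2]; simpl; intros e; subst v.
now rewrite (proof_irrelevance _ u1 v1), (proof_irrelevance _ u2 v2).
Qed.

Definition point_id (C : Category) (Y : C) (P : Point Y) : PointHom P P :=
  Build_PointHom (comp_id_r (pt_map P)) (comp_id_l (pt_sec P)).

Definition point_comp (C : Category) (Y : C) (P Q R : Point Y)
  (v : PointHom Q R) (u : PointHom P Q) : PointHom P R.
Proof.
refine (@Build_PointHom C Y P R (ph_map v ∘ ph_map u) _ _).
- now rewrite comp_assoc, !ph_over.
- now rewrite <- comp_assoc, !ph_sec.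
Defined.

Definition Pt (C : Category) (Y : C) : Category.
Proof.
refine {| Ob := Point Y; Hom := @PointHom C Y;
          idm := @point_id C Y; comp := @point_comp C Y |}.
- intros P Q u; apply PointHom_ext, comp_id_l.
- intros P Q u; apply PointHom_ext, comp_id_r.
- intros P Q R S w v u; apply PointHom_ext, comp_assoc.
Defined.

Section ChangeOfBase.
Variables (C : Category) (L : FinitelyComplete C) (X Y : C) (h : Hom X Y).

Lemma cob_sec_eq (P : Pt Y) : h ∘ idm X = pt_map P ∘ (pt_sec P ∘ h).
Proof. now rewrite comp_assoc, pt_split, comp_id_l, comp_id_r. Qed.

Definition cob_obj (P : Pt Y) : Pt X :=
  @Build_Point C X (pb L h (pt_map P)) (pb_fst L h (pt_map P))
    (pb_lift L (cob_sec_eq P)) (pb_lift_fst L (cob_sec_eq P)).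

Lemma cob_map_eq (P Q : Pt Y) (u : Hom P Q) :
  h ∘ pb_fst L h (pt_map P) = pt_map Q ∘ (ph_map u ∘ pb_snd L h (pt_map P)).
Proof. now rewrite comp_assoc, ph_over, pb_comm. Qed.

Definition cob_map (P Q : Pt Y) (u : Hom P Q) : Hom (cob_obj P) (cob_obj Q).
Proof.
refine (@Build_PointHom C X (cob_obj P) (cob_obj Q)
          (pb_lift L (cob_map_eq u)) _ _).
- apply pb_lift_fst.
- apply pb_ext; simpl; rewrite comp_assoc, ?pb_lift_fst, ?pb_lift_snd; auto.
  now rewrite <- comp_assoc, pb_lift_snd, comp_assoc, ph_sec.
Defined.

Definition change_of_base : Functor (Pt Y) (Pt X).
Proof.
refine (@Build_Functor (Pt Y) (Pt X) cob_obj cob_map _ _).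
- intros P; apply PointHom_ext, pb_ext; simpl;
    rewrite ?pb_lift_fst, ?pb_lift_snd, ?comp_id_l, ?comp_id_r; auto.
- intros P Q R v u; apply PointHom_ext, pb_ext; simpl;
    rewrite comp_assoc, ?pb_lift_fst, ?pb_lift_snd; auto.
  now rewrite <- (comp_assoc _ (pb_snd L h _)), pb_lift_snd, comp_assoc.
Defined.

End ChangeOfBase.

(** * Equivalence relations and normal monomorphisms *)

Definition related {C : Category} {R X : C} (r1 r2 : Hom R X)
  (T : C) (x y : Hom T X) : Prop :=
  exists u : Hom T R, r1 ∘ u = x /\ r2 ∘ u = y.

(** A jointly monic pair of maps to [X] inducing an equivalence relation on
    each set of generalized elements [Hom T X]. *)
Record EquivRel (C : Category) (X : C) : Type := {
  er_ob : C;
  er_fst : Hom er_ob X;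
  er_snd : Hom er_ob X;
  er_monic : forall (T : C) (u v : Hom T er_ob),
    er_fst ∘ u = er_fst ∘ v -> er_snd ∘ u = er_snd ∘ v -> u = v;
  er_refl : forall (T : C) (x : Hom T X), related er_fst er_snd x x;
  er_sym : forall (T : C) (x y : Hom T X),
    related er_fst er_snd x y -> related er_fst er_snd y x;
  er_trans : forall (T : C) (x y z : Hom T X),
    related er_fst er_snd x y -> related er_fst er_snd y z ->
    related er_fst er_snd x z
}.

Definition indiscrete (C : Category) (X : C) (N : EquivRel X) : Prop :=
  is_product (er_fst N) (er_snd N).

(** The pullback squares contain the equations making [phi] a morphism of
    equivalence relations over [m]. *)
Definition discrete_fibration (C : Category) (X' X : C)
  (R' : EquivRel X') (R : EquivRel X)
  (m : Hom X' X) (phi : Hom (er_ob R') (er_ob R)) : Prop :=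
  is_pullback m (er_fst R) (er_fst R') phi /\
  is_pullback m (er_snd R) (er_snd R') phi.

(** No choice of products is assumed: the indiscrete relation on [X'] is any
    relation whose projections form a product diagram; it is unique up to
    isomorphism. *)
Definition normal_to (C : Category) (X' X : C) (m : Hom X' X) (R : EquivRel X) :
  Prop :=
  exists N : EquivRel X', indiscrete N /\
    exists phi : Hom (er_ob N) (er_ob R), discrete_fibration m phi.

Definition normal_mono (C : Category) (X' X : C) (m : Hom X' X) : Prop :=
  monic m /\ exists R : EquivRel X, normal_to m R.

Definition conservative (C D : Category) (F : Functor C D) : Prop :=
  forall (A B : C) (f : Hom A B), iso (fmap F f) -> iso f.

Definition reflects_normal_monos (C D : Category) (F : Functor C D) : Prop :=
  forall (A B : C) (m : Hom A B), normal_mono (fmap F m) -> normal_mono m.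

Definition normal_functor (C D : Category) (F : Functor C D) : Prop :=
  left_exact F /\ conservative F /\ reflects_normal_monos F.

Definition protomodular (C : Category) (L : FinitelyComplete C) : Prop :=
  forall (X Y : C) (h : Hom X Y), conservative (change_of_base L h).

Definition locally_algebraically_cartesian_closed (C : Category)
  (L : FinitelyComplete C) : Prop :=
  forall (X Y : C) (h : Hom X Y), has_right_adjoint (change_of_base L h).

Definition strongly_protomodular (C : Category) (L : FinitelyComplete C) : Prop :=
  protomodular L /\
  forall (X Y : C) (h : Hom X Y), normal_functor (change_of_base L h).

(* Main.v *)
From Stdlib Require Import List ClassicalEpsilon.
Require Import Defs.

(** The change of base functor [h^* : Pt Y -> Pt X] is left exact, it is
    conservative by protomodularity, and it has a right adjoint; its domain is
    pointed. Every functor [F] with these properties reflects normal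
    monomorphisms ([right_adjoint_reflects_normal_monos]), as follows.

    Let [F m] be normal to [S], where [m : A -> B], and let [G] be the right
    adjoint of [F]. The functor [G] carries [S] to a relation on [G (F B)], and
    pulling that back along the unit gives the largest relation [R] on [B] whose
    image under [F] lies in [S]: generalized elements [x, y] of [B] are
    [R]-related exactly when [F x, F y] are [S]-related
    ([related_transpose_relation]). Hence [R] is an equivalence relation. The
    [R]-class of zero consists of the [b] such that [F b] is [S]-related to
    zero, which means, as [F m] is normal to [S], that [F b] factors through
    [F m]. A left exact conservative functor reflects factorizations through a
    mono ([reflects_factorization]), so this class is exactly [A].

    In a pointed category this is enough to make [m] normal to [R]
    ([normal_to_zero_class]): if [m a] is related to [b], then so is zero, since
    zero is related to [m a]; so [b] comes from a unique element of [A], which is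
    the discrete fibration property.

    Both the finite limits of [Pt Y] and the left exactness of [h^*] come from
    one observation: a limit of points over [Y] is a limit in the ambient
    category of the same diagram with its maps to [Y] added. Such limits have a
    universal property with respect to all objects, not only to points over [Y],
    and can therefore be tested against objects over [X]. *)

Local Open Scope cat_scope.

(** * Limits and pullbacks *)

Definition mediate {J C : Category} {D : Functor J C} {c : Cone D}
  (H : is_limit c) (c' : Cone D) : Hom (apex c') (apex c) :=
  proj1_sig (constructive_definite_description _ (H c')).

Lemma mediate_leg {J C : Category} {D : Functor J C} {c : Cone D}
  (H : is_limit c) (c' : Cone D) (j : J) : leg c j ∘ mediate H c' = leg c' j.
Proof.
unfold mediate; destruct constructive_definite_description as [u Hu]; apply Hu.
Qed.

Lemma limit_ext {J C : Category} {D : Functor J C} {c : Cone D}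
  (H : is_limit c) {T : C} (u v : Hom T (apex c)) :
  (forall j, leg c j ∘ u = leg c j ∘ v) -> u = v.
Proof.
intros E.
assert (N : forall (i j : J) (a : Hom i j),
  fmap D a ∘ (leg c i ∘ v) = leg c j ∘ v)
  by (intros i j a; now rewrite comp_assoc, leg_natural).
destruct (H (Build_Cone N)) as [w [_ Hw]].
transitivity w; [symmetry |]; apply Hw; simpl; auto.
Qed.

Lemma pullback_ext {C : Category} {A B D P : C} {f : Hom A D} {g : Hom B D}
  {p : Hom P A} {q : Hom P B} (H : is_pullback f g p q) {T : C} (u v : Hom T P) :
  p ∘ u = p ∘ v -> q ∘ u = q ∘ v -> u = v.
Proof.
intros Ep Eq; destruct H as [E U].
destruct (U T (p ∘ v) (q ∘ v)) as [w [_ Hw]];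
  [now rewrite !comp_assoc, E |].
now rewrite <- (Hw u), <- (Hw v).
Qed.

Lemma product_ext {C : Category} {A B P : C} {p : Hom P A} {q : Hom P B}
  (H : is_product p q) {T : C} (u v : Hom T P) :
  p ∘ u = p ∘ v -> q ∘ u = q ∘ v -> u = v.
Proof.
intros Ep Eq; destruct (H T (p ∘ v) (q ∘ v)) as [w [_ Hw]].
now rewrite <- (Hw u), <- (Hw v).
Qed.

Lemma left_exact_pullback {C E : Category} {F : Functor C E} (HF : left_exact F)
  {A B D P : C} {f : Hom A D} {g : Hom B D} {p : Hom P A} {q : Hom P B} :
  is_pullback f g p q -> is_pullback (fmap F f) (fmap F g) (fmap F p) (fmap F q).
Proof.
intros [e U].
set (l := fun j : cospan => match j return Hom P (cospan_functor f g j) with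
  | c_left => p | c_right => q | c_base => f ∘ p end).
assert (N : forall (i j : cospan) (x : Hom i j),
  fmap (cospan_functor f g) x ∘ l i = l j)
  by (intros [] [] []; simpl; rewrite ?comp_id_l; auto).
assert (Hc : is_limit (Build_Cone N)).
{ intros c'.
  assert (El : f ∘ leg c' c_left = leg c' c_base)
    by exact (leg_natural c' (i := c_left) (j := c_base) tt).
  assert (Er : g ∘ leg c' c_right = leg c' c_base)
    by exact (leg_natural c' (i := c_right) (j := c_base) tt).
  destruct (U _ (leg c' c_left) (leg c' c_right)) as [u [[Hp Hq] Hu]];
    [now rewrite El, Er |].
  exists u; split.
  - intros []; simpl; auto.
    change (f ∘ p ∘ u = leg c' c_base); now rewrite <- comp_assoc, Hp.
  - intros v Hv; apply Hu; split; [exact (Hv c_left) | exact (Hv c_right)]. }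
split; [now rewrite <- !fmap_comp, e |].
intros T a b E'.
set (l' := fun j : cospan =>
  match j return Hom T (functor_comp F (cospan_functor f g) j) with
  | c_left => a | c_right => b | c_base => fmap F f ∘ a end).
assert (N' : forall (i j : cospan) (x : Hom i j),
  fmap (functor_comp F (cospan_functor f g)) x ∘ l' i = l' j)
  by (intros [] [] []; simpl; rewrite ?fmap_id, ?comp_id_l; auto).
destruct (HF _ _ cospan_finite _ Hc (Build_Cone N')) as [u [Hu Uu]].
exists u; split.
- split; [exact (Hu c_left) | exact (Hu c_right)].
- intros v [Hp Hq]; apply Uu; intros []; simpl; auto.
  now rewrite fmap_comp, <- comp_assoc, Hp.
Qed.

(** * Limits of points *)

(** Adding the base to a diagram of points also accounts for the empty diagram,
    whose limit among points over [Y] is [Y] itself. *)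
Section AdjoinTerminal.
Variable J : Category.

Definition adjoin_terminal_hom (i j : option J) : Type :=
  match i, j with
  | Some i, Some j => Hom i j
  | _, None => unit
  | None, Some _ => Empty_set
  end.

Definition adjoin_terminal : Category.
Proof.
refine {| Ob := option J; Hom := adjoin_terminal_hom;
  idm := fun i => match i return adjoin_terminal_hom i i with
                  | Some i => idm i | None => tt end;
  comp := fun i j k => match i, j, k return
      adjoin_terminal_hom j k -> adjoin_terminal_hom i j ->
      adjoin_terminal_hom i k with
    | Some i, Some j, Some k => fun b a => b ∘ a
    | _, None, Some _ => fun b _ => match b with end
    | None, Some _, _ => fun _ a => match a with end
    | _, _, None => fun _ _ => tt
    end |}.
- intros [i |] [j |] f; simpl; [apply comp_id_l | now destruct f .. ].
- intros [i |] [j |] f; simpl; [apply comp_id_r | now destruct f .. ].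
- intros [i |] [j |] [k |] [l |] h g f; simpl;
    first [ apply comp_assoc | now destruct f | now destruct g | now destruct h ].
Defined.

Lemma adjoin_terminal_finite : finite_category J -> finite_category adjoin_terminal.
Proof.
intros [[l Hl] H]; split.
- exists (None :: map Some l); intros [j |]; simpl; auto.
  right; now apply in_map.
- intros [i |] [j |]; simpl; [apply H | ..];
    first [ now exists (tt :: nil); intros []; left | now exists nil; intros [] ].
Qed.

End AdjoinTerminal.

Section PointLimits.
Variables (C : Category) (L : FinitelyComplete C) (Y : C).
Variables (J : Category) (D : Functor J (Pt Y)) (fJ : finite_category J).

Definition base_diagram_ob (i : option J) : C :=
  match i with Some i => pt_dom (D i) | None => Y end.

Definition base_diagram : Functor (adjoin_terminal J) C.
Proof.
refine (@Build_Functor (adjoin_terminal J) C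
  base_diagram_ob
  (fun i j => match i, j return
      adjoin_terminal_hom J i j -> Hom (base_diagram_ob i) (base_diagram_ob j) with
    | Some i, Some j => fun a => ph_map (fmap D a)
    | Some i, None => fun _ => pt_map (D i)
    | None, None => fun _ => idm Y
    | None, Some _ => fun a => match a with end
    end) _ _).
- intros [i |]; simpl; auto; now rewrite fmap_id.
- intros [i |] [j |] [k |] b a; simpl; try destruct a; try destruct b;
    rewrite ?comp_id_l, ?fmap_comp, ?ph_over; auto.
Defined.

Definition base_limit : Cone base_diagram :=
  lim L base_diagram (adjoin_terminal_finite J fJ).

Definition base_limit_is_limit : is_limit base_limit :=
  lim_is_limit L (adjoin_terminal_finite J fJ).

Lemma base_limit_over (j : J) :
  pt_map (D j) ∘ leg base_limit (Some j) = leg base_limit None.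
Proof. exact (leg_natural base_limit (i := Some j) (j := None) tt). Qed.

Lemma base_limit_natural (i j : J) (a : Hom i j) :
  ph_map (fmap D a) ∘ leg base_limit (Some i) = leg base_limit (Some j).
Proof. exact (leg_natural base_limit (i := Some i) (j := Some j) a). Qed.

Section Universal.
Variables (T : C) (t : Hom T Y) (u : forall j : J, Hom T (pt_dom (D j))).
Hypothesis u_over : forall j, pt_map (D j) ∘ u j = t.
Hypothesis u_natural : forall (i j : J) (a : Hom i j),
  ph_map (fmap D a) ∘ u i = u j.

Definition base_cone : Cone base_diagram.
Proof.
refine (@Build_Cone _ _ base_diagram T
  (fun j => match j return Hom T (base_diagram j) with
            | Some j => u j | None => t end) _).
intros [i |] [j |] a; simpl; try destruct a; rewrite ?comp_id_l; auto.
Defined.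

Definition base_map : Hom T (apex base_limit) :=
  mediate base_limit_is_limit base_cone.

Lemma base_map_over : leg base_limit None ∘ base_map = t.
Proof. exact (mediate_leg base_limit_is_limit base_cone None). Qed.

Lemma base_map_leg (j : J) : leg base_limit (Some j) ∘ base_map = u j.
Proof. exact (mediate_leg base_limit_is_limit base_cone (Some j)). Qed.

End Universal.

Lemma base_limit_ext (T : C) (u v : Hom T (apex base_limit)) :
  leg base_limit None ∘ u = leg base_limit None ∘ v ->
  (forall j : J, leg base_limit (Some j) ∘ u = leg base_limit (Some j) ∘ v) ->
  u = v.
Proof. intros E0 E; apply (limit_ext base_limit_is_limit); intros [j |]; auto. Qed.

(** The sections of the points of [D] and the identity of [Y] form a cone on
    [base_diagram D], so they make its limit a point over [Y]. *)
Definition base_section : Hom Y (apex base_limit) :=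
  base_map Y (idm Y) (fun j => pt_sec (D j)) (fun j => pt_split (D j))
    (fun i j a => ph_sec (fmap D a)).

Lemma base_section_split : leg base_limit None ∘ base_section = idm Y.
Proof. apply base_map_over. Qed.

Lemma base_section_leg (j : J) :
  leg base_limit (Some j) ∘ base_section = pt_sec (D j).
Proof. apply (base_map_leg Y (idm Y) (fun j => pt_sec (D j))). Qed.

Definition limit_point : Pt Y := Build_Point base_section_split.

Definition limit_point_cone : Cone D.
Proof.
refine (@Build_Cone J (Pt Y) D limit_point
  (fun j => @Build_PointHom C Y limit_point (D j) (leg base_limit (Some j))
     (base_limit_over j) (base_section_leg j)) _).
intros i j a; apply PointHom_ext, base_limit_natural.
Defined.

Lemma limit_point_is_limit : is_limit limit_point_cone.
Proof.
intros c'.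
set (Ov := fun j => ph_over (leg c' j)).
set (Nt := fun i j (a : Hom i j) =>
  f_equal (fun w => ph_map w) (leg_natural c' a)).
set (u := base_map (pt_dom (apex c')) _ (fun j => ph_map (leg c' j)) Ov Nt).
assert (u0 : leg base_limit None ∘ u = pt_map (apex c')) by apply base_map_over.
assert (u1 : forall j, leg base_limit (Some j) ∘ u = ph_map (leg c' j))
  by apply (base_map_leg _ _ (fun j => ph_map (leg c' j))).
assert (Hs : u ∘ pt_sec (apex c') = pt_sec limit_point).
{ simpl; apply base_limit_ext; [| intros j]; rewrite comp_assoc.
  - rewrite u0, base_section_split; apply pt_split.
  - rewrite u1, base_section_leg; apply ph_sec. }
exists (@Build_PointHom C Y (apex c') limit_point u u0 Hs); split.
- intros j; apply PointHom_ext, u1.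
- intros v Hv; apply PointHom_ext; simpl.
  apply base_limit_ext; [| intros j].
  + rewrite u0; symmetry; exact (ph_over v).
  + now rewrite u1, <- (Hv j).
Qed.

End PointLimits.

Arguments base_map {C} L {Y J D} fJ {T} t u _ _.
Arguments base_map_leg {C} L {Y J D} fJ {T} t u _ _ j.
Arguments base_limit {C} L {Y J} D fJ.
Arguments limit_point {C} L {Y J} D fJ.
Arguments limit_point_cone {C} L {Y J} D fJ.
Arguments limit_point_is_limit {C} L {Y J} D fJ.

Definition point_finitely_complete {C : Category} (L : FinitelyComplete C) (Y : C) :
  FinitelyComplete (Pt Y) :=
  {| lim := @limit_point_cone C L Y; lim_is_limit := @limit_point_is_limit C L Y |}.

Section ChangeOfBaseLeftExact.
Variables (C : Category) (L : FinitelyComplete C) (X Y : C) (h : Hom X Y).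

Lemma change_of_base_ext (T : Pt X) (P : Pt Y)
  (u v : Hom T (change_of_base L h P)) :
  pb_snd L h (pt_map P) ∘ ph_map u = pb_snd L h (pt_map P) ∘ ph_map v -> u = v.
Proof.
intros E; apply PointHom_ext, pb_ext; auto.
transitivity (pt_map T); [| symmetry];
  [exact (ph_over u) | exact (ph_over v)].
Qed.

Lemma change_of_base_lift (T : Pt X) (P : Pt Y)
  (u : Hom (pt_dom T) (pt_dom P)) :
  pt_map P ∘ u = h ∘ pt_map T -> u ∘ pt_sec T = pt_sec P ∘ h ->
  exists v : Hom T (change_of_base L h P), pb_snd L h (pt_map P) ∘ ph_map v = u.
Proof.
intros E S; symmetry in E.
assert (S' : pb_lift L E ∘ pt_sec T = pt_sec (change_of_base L h P)).
{ apply pb_ext; simpl; rewrite comp_assoc, ?pb_lift_fst, ?pb_lift_snd; auto.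
  apply pt_split. }
exists (@Build_PointHom C X T (change_of_base L h P) (pb_lift L E)
  (pb_lift_fst L E) S'); apply pb_lift_snd.
Qed.

Lemma change_of_base_snd (T : Pt X) (P Q : Pt Y) (u : Hom P Q)
  (v : Hom T (change_of_base L h P)) :
  pb_snd L h (pt_map Q) ∘ ph_map (fmap (change_of_base L h) u ∘ v) =
  ph_map u ∘ (pb_snd L h (pt_map P) ∘ ph_map v).
Proof. simpl; now rewrite !comp_assoc, pb_lift_snd. Qed.

(** A cone of points over [X] on the image of [D] is a cone in the ambient
    category on [D] with its base [Y] added, so it factors through the limit of
    the latter, which is the given limit up to isomorphism of points. *)
Lemma change_of_base_left_exact : left_exact (change_of_base L h).
Proof.
intros J D fJ c Hc.
set (Z := limit_point_cone L D fJ).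
destruct (Hc Z) as [w [Hw _]]; change (Hom (apex Z) (apex c)) in w.
assert (Ek : exists k : Hom (apex c) (apex Z), forall j, leg Z j ∘ k = leg c j)
  by (destruct (limit_point_is_limit L D fJ c) as [k [Hk _]]; now exists k).
destruct Ek as [k Hk].
assert (wk : w ∘ k = idm (apex c)).
{ apply (limit_ext Hc); intros j.
  now rewrite comp_assoc, Hw, Hk, comp_id_r. }
intros c'.
assert (Ov : forall j, pt_map (D j) ∘ (pb_snd L h (pt_map (D j)) ∘ ph_map (leg c' j))
  = h ∘ pt_map (apex c')).
{ intros j; rewrite comp_assoc, <- pb_comm, <- comp_assoc.
  f_equal; exact (ph_over (leg c' j)). }
assert (Nt : forall (i j : J) (a : Hom i j),
  ph_map (fmap D a) ∘ (pb_snd L h (pt_map (D i)) ∘ ph_map (leg c' i)) =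
  pb_snd L h (pt_map (D j)) ∘ ph_map (leg c' j)).
{ intros i j a; rewrite <- (leg_natural c' a).
  symmetry; apply change_of_base_snd. }
set (z := base_map L fJ _ _ Ov Nt).
assert (z0 : leg (base_limit L D fJ) None ∘ z = h ∘ pt_map (apex c'))
  by apply base_map_over.
assert (z1 : forall j, leg (base_limit L D fJ) (Some j) ∘ z =
    pb_snd L h (pt_map (D j)) ∘ ph_map (leg c' j))
  by exact (base_map_leg L fJ _ _ Ov Nt).
assert (zs : z ∘ pt_sec (apex c') = pt_sec (limit_point L D fJ) ∘ h).
{ simpl; apply base_limit_ext; [| intros j]; rewrite !comp_assoc.
  - now rewrite z0, base_section_split, <- comp_assoc, pt_split, comp_id_l, comp_id_r.
  - rewrite z1, base_section_leg, <- comp_assoc.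
    transitivity (pb_snd L h (pt_map (D j)) ∘ pt_sec (change_of_base L h (D j))).
    + f_equal; exact (ph_sec (leg c' j)).
    + apply pb_lift_snd. }
destruct (change_of_base_lift (apex c') (apex c) (ph_map w ∘ z)) as [v Hv].
- rewrite comp_assoc, ph_over; exact z0.
- transitivity (ph_map w ∘ (pt_sec (limit_point L D fJ) ∘ h)).
  + now rewrite <- zs, comp_assoc.
  + rewrite comp_assoc; f_equal; exact (ph_sec w).
- exists v; split.
  + intros j; apply change_of_base_ext.
    etransitivity; [apply change_of_base_snd |].
    rewrite Hv, comp_assoc.
    change (ph_map (leg c j ∘ w) ∘ z = pb_snd L h (pt_map (D j)) ∘ ph_map (leg c' j)).
    rewrite Hw; exact (z1 j).
  + intros v' Hv'; apply change_of_base_ext.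
    rewrite Hv.
    (* [w] is split by [k], so it is enough to compare the maps into [Z]. *)
    assert (E : z = ph_map k ∘ (pb_snd L h (pt_map (apex c)) ∘ ph_map v')).
    { apply base_limit_ext; [| intros j]; rewrite ?z0, ?z1, comp_assoc.
      - change (h ∘ pt_map (apex c') = pt_map (apex Z) ∘ ph_map k ∘
          (pb_snd L h (pt_map (apex c)) ∘ ph_map v')).
        rewrite (ph_over k), comp_assoc, <- pb_comm, <- comp_assoc.
        f_equal; symmetry; exact (ph_over v').
      - change (pb_snd L h (pt_map (D j)) ∘ ph_map (leg c' j) =
          ph_map (leg Z j ∘ k) ∘ (pb_snd L h (pt_map (apex c)) ∘ ph_map v')).
        rewrite Hk, <- (Hv' j); apply change_of_base_snd. }
    rewrite E, comp_assoc.
    change (ph_map (w ∘ k) ∘ (pb_snd L h (pt_map (apex c)) ∘ ph_map v') =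
      pb_snd L h (pt_map (apex c)) ∘ ph_map v').
    rewrite wk; apply comp_id_l.
Qed.

End ChangeOfBaseLeftExact.

(** * Left exact conservative functors and monomorphisms *)

Section Conservative.
Variables (D E : Category) (L : FinitelyComplete D) (F : Functor D E).
Hypotheses (HF : left_exact F) (cF : conservative F).

(** The kernel pair of [m] is carried to that of the mono [F m], so its
    projections become invertible under [F], hence are already invertible. *)
Lemma reflects_monic {A B : D} (m : Hom A B) : monic (fmap F m) -> monic m.
Proof.
intros Hm.
set (p := pb_fst L m m); set (q := pb_snd L m m).
set (d := pb_lift L (eq_refl (m ∘ idm A))).
assert (pd : p ∘ d = idm A) by apply pb_lift_fst.
assert (qd : q ∘ d = idm A) by apply pb_lift_snd.
assert (HP := left_exact_pullback HF (pb_is_pullback L m m)).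
assert (pq : fmap F p = fmap F q) by exact (Hm _ _ _ (proj1 HP)).
assert (ip : iso p).
{ apply cF; exists (fmap F d); split.
  - apply (pullback_ext HP); fold p q;
      rewrite comp_assoc, <- (fmap_comp F _ d), ?pd, ?qd, fmap_id, comp_id_l, comp_id_r;
      auto.
  - now rewrite <- fmap_comp, pd, fmap_id. }
destruct ip as [g [gp pg]].
assert (e : p = q).
{ assert (gd : g = d)
    by (rewrite <- (comp_id_l d), <- gp, <- comp_assoc, pd; now rewrite comp_id_r).
  subst g; rewrite <- (comp_id_r q), <- gp, comp_assoc, qd; now rewrite comp_id_l. }
intros T u v Huv.
transitivity (p ∘ pb_lift L Huv); [symmetry; apply pb_lift_fst |].
rewrite e; apply pb_lift_snd.
Qed.

(** The pullback of [m] along [b] is carried to the pullback of [F m] along a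
    map that factors through it, which is invertible. *)
Lemma reflects_factorization {A B T : D} (m : Hom A B) (b : Hom T B)
  (w : Hom (F T) (F A)) :
  monic (fmap F m) -> fmap F b = fmap F m ∘ w -> exists c : Hom T A, b = m ∘ c.
Proof.
intros Hm Hw.
assert (HP := left_exact_pullback HF (pb_is_pullback L b m)).
set (p := pb_fst L b m) in *; set (q := pb_snd L b m) in *.
assert (ip : iso p).
{ apply cF.
  destruct (proj2 HP (F T) (idm _) w) as [g [[g1 g2] _]];
    [now rewrite comp_id_r |].
  exists g; split; auto.
  apply (pullback_ext HP); rewrite comp_assoc, ?g1, ?g2, comp_id_r.
  - apply comp_id_l.
  - apply Hm; rewrite comp_assoc, <- Hw; apply HP. }
destruct ip as [g [_ pg]].
exists (q ∘ g); rewrite comp_assoc; unfold q; rewrite <- pb_comm; fold p.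
now rewrite <- comp_assoc, pg, comp_id_r.
Qed.

End Conservative.

(** * Normal monomorphisms in a pointed category *)

Record Pointed (D : Category) : Type := {
  zero_ob : D;
  to_zero : forall A : D, Hom A zero_ob;
  from_zero : forall A : D, Hom zero_ob A;
  to_zero_unique : forall (A : D) (u v : Hom A zero_ob), u = v;
  from_zero_unique : forall (A : D) (u v : Hom zero_ob A), u = v
}.

Arguments zero_ob {D} p.
Arguments to_zero {D} p A.
Arguments from_zero {D} p A.
Arguments to_zero_unique {D} p {A} u v.
Arguments from_zero_unique {D} p {A} u v.

Definition zero {D : Category} (Z : Pointed D) (A B : D) : Hom A B :=
  from_zero Z B ∘ to_zero Z A.

Lemma comp_zero_r {D : Category} (Z : Pointed D) {A B T : D} (f : Hom A B) :
  f ∘ zero Z T A = zero Z T B.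
Proof.
unfold zero; rewrite comp_assoc; f_equal; apply (from_zero_unique Z).
Qed.


Definition point_pointed (C : Category) (Y : C) : Pointed (Pt Y).
Proof.
pose (Z := Build_Point (comp_id_l (idm Y)) : Pt Y).
refine (@Build_Pointed (Pt Y) Z
  (fun A => @Build_PointHom C Y A Z (pt_map A) (comp_id_l _) (pt_split A))
  (fun A => @Build_PointHom C Y Z A (pt_sec A) (pt_split A) (comp_id_r _)) _ _).
- intros A u v; apply PointHom_ext.
  rewrite <- (comp_id_l (ph_map u)), <- (comp_id_l (ph_map v)).
  transitivity (pt_map A); [| symmetry];
    [exact (ph_over u) | exact (ph_over v)].
- intros A u v; apply PointHom_ext.
  rewrite <- (comp_id_r (ph_map u)), <- (comp_id_r (ph_map v)).
  transitivity (pt_sec A); [| symmetry];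
    [exact (ph_sec u) | exact (ph_sec v)].
Defined.

Section ZeroClass.
Variables (D : Category) (L : FinitelyComplete D) (Z : Pointed D).

Lemma square_product (A : D) :
  is_product (pb_fst L (to_zero Z A) (to_zero Z A))
             (pb_snd L (to_zero Z A) (to_zero Z A)).
Proof.
intros T a b; apply pb_is_pullback; apply (to_zero_unique Z).
Qed.

Definition indiscrete_rel (A : D) : EquivRel A.
Proof.
refine (@Build_EquivRel D A _ _ _ (fun T u v => product_ext (square_product A) u v)
  _ _ _).
- intros T x; destruct (square_product A T x x) as [u [Hu _]]; now exists u.
- intros T x y _; destruct (square_product A T y x) as [u [Hu _]]; now exists u.
- intros T x y z _ _; destruct (square_product A T x z) as [u [Hu _]]; now exists u.
Defined.

(** The missing vertex of either square is found inside the zero class, by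
    symmetry and transitivity through zero, to which every [m a] is related. *)
Lemma normal_to_zero_class {A B : D} (m : Hom A B) (R : EquivRel B) :
  monic m ->
  (forall (T : D) (b : Hom T B),
    related (er_fst R) (er_snd R) (zero Z T B) b <-> exists a, b = m ∘ a) ->
  normal_to m R.
Proof.
intros Hm K.
assert (K0 : forall (T : D) (a : Hom T A),
  related (er_fst R) (er_snd R) (zero Z T B) (m ∘ a))
  by (intros T a; apply K; now exists a).
exists (indiscrete_rel A); split; [exact (square_product A) |].
set (N := indiscrete_rel A).
assert (HN : is_product (er_fst N) (er_snd N)) by exact (square_product A).
destruct (er_trans (er_sym (K0 _ (er_fst N))) (K0 _ (er_snd N)))
  as [phi [phi1 phi2]].
exists phi; split; (split; [easy |]); intros T a u E.
- destruct (proj1 (K T (er_snd R ∘ u))) as [a' Ha'].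
  { apply (er_trans (K0 T a)); exists u; auto. }
  destruct (HN T a a') as [w [[w1 w2] Uw]].
  exists w; split.
  + split; auto; apply er_monic; rewrite comp_assoc.
    * now rewrite phi1, <- comp_assoc, w1.
    * now rewrite phi2, <- comp_assoc, w2.
  + intros v [v1 v2]; apply Uw; split; auto.
    apply Hm; now rewrite comp_assoc, <- phi2, <- comp_assoc, v2.
- destruct (proj1 (K T (er_fst R ∘ u))) as [a' Ha'].
  { apply (er_trans (K0 T a)), er_sym; exists u; auto. }
  destruct (HN T a' a) as [w [[w1 w2] Uw]].
  exists w; split.
  + split; auto; apply er_monic; rewrite comp_assoc.
    * now rewrite phi1, <- comp_assoc, w1.
    * now rewrite phi2, <- comp_assoc, w2.
  + intros v [v1 v2]; apply Uw; split; auto.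
    apply Hm; now rewrite comp_assoc, <- phi1, <- comp_assoc, v2.
Qed.

End ZeroClass.

(** * Transporting a relation along a right adjoint *)

Section Transpose.
Variables (D E : Category) (L : FinitelyComplete D).
Variables (F : Functor D E) (G : Functor E D) (adj : Adjunction F G).

Definition transpose {T : D} {S : E} (u : Hom (F T) S) : Hom T (G S) :=
  fmap G u ∘ adj_unit adj T.

Definition untranspose {T : D} {S : E} (u : Hom T (G S)) : Hom (F T) S :=
  adj_counit adj S ∘ fmap F u.

Lemma untranspose_transpose {T : D} {S : E} (u : Hom (F T) S) :
  untranspose (transpose u) = u.
Proof.
unfold transpose, untranspose.
rewrite fmap_comp, comp_assoc, <- adj_counit_natural, <- comp_assoc.
now rewrite adj_triangle_l, comp_id_r.
Qed.

Lemma transpose_untranspose {T : D} {S : E} (u : Hom T (G S)) :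
  transpose (untranspose u) = u.
Proof.
unfold transpose, untranspose.
rewrite fmap_comp, <- comp_assoc, <- adj_unit_natural, comp_assoc.
now rewrite adj_triangle_r, comp_id_l.
Qed.

Lemma transpose_fmap {T B : D} (x : Hom T B) :
  transpose (fmap F x) = adj_unit adj B ∘ x.
Proof. symmetry; apply adj_unit_natural. Qed.

Lemma transpose_comp {T : D} {S S' : E} (s : Hom S S') (u : Hom (F T) S) :
  transpose (s ∘ u) = fmap G s ∘ transpose u.
Proof. unfold transpose; now rewrite fmap_comp, comp_assoc. Qed.

Lemma untranspose_comp {T : D} {S S' : E} (s : Hom S S') (u : Hom T (G S)) :
  untranspose (fmap G s ∘ u) = s ∘ untranspose u.
Proof.
now rewrite <- (transpose_untranspose u), <- transpose_comp,
  !untranspose_transpose.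
Qed.

Lemma fmap_right_jointly_monic {S B : E} (s1 s2 : Hom S B) :
  (forall (T : E) (u v : Hom T S), s1 ∘ u = s1 ∘ v -> s2 ∘ u = s2 ∘ v -> u = v) ->
  forall (T : D) (u v : Hom T (G S)),
    fmap G s1 ∘ u = fmap G s1 ∘ v -> fmap G s2 ∘ u = fmap G s2 ∘ v -> u = v.
Proof.
intros H T u v E1 E2.
rewrite <- (transpose_untranspose u), <- (transpose_untranspose v); f_equal.
apply H; rewrite <- !untranspose_comp; now f_equal.
Qed.

Section Relation.
Variables (B : D) (S : EquivRel (F B)).

Let eta := adj_unit adj B.
Let g1 := fmap G (er_fst S).
Let g2 := fmap G (er_snd S).

Let left_pb : D := pb L eta g1.
Let left_snd : Hom left_pb (G (er_ob S)) := pb_snd L eta g1.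

(** An element of this object consists of [x] and [y] in [B] and a proof in
    [G S] that their images under the unit are related; the iterated pullback
    replaces that of [G S] along the square of the unit. *)
Definition transpose_rel_ob : D := pb L eta (g2 ∘ left_snd).
Definition transpose_rel_fst : Hom transpose_rel_ob B :=
  pb_fst L eta g1 ∘ pb_snd L eta (g2 ∘ left_snd).
Definition transpose_rel_snd : Hom transpose_rel_ob B :=
  pb_fst L eta (g2 ∘ left_snd).

Definition transpose_rel_proof : Hom transpose_rel_ob (G (er_ob S)) :=
  left_snd ∘ pb_snd L eta (g2 ∘ left_snd).

Lemma transpose_rel_fst_eq : eta ∘ transpose_rel_fst = g1 ∘ transpose_rel_proof.
Proof.
unfold transpose_rel_fst, transpose_rel_proof, left_snd.
rewrite !comp_assoc; f_equal; apply pb_comm.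
Qed.

Lemma transpose_rel_snd_eq : eta ∘ transpose_rel_snd = g2 ∘ transpose_rel_proof.
Proof. unfold transpose_rel_proof; rewrite comp_assoc; apply pb_comm. Qed.

Lemma transpose_rel_monic (T : D) (u v : Hom T transpose_rel_ob) :
  transpose_rel_fst ∘ u = transpose_rel_fst ∘ v ->
  transpose_rel_snd ∘ u = transpose_rel_snd ∘ v -> u = v.
Proof.
intros E1 E2.
assert (Ep : transpose_rel_proof ∘ u = transpose_rel_proof ∘ v).
{ apply (fmap_right_jointly_monic _ _ (@er_monic _ _ S)); fold g1 g2;
    rewrite !comp_assoc.
  - now rewrite <- transpose_rel_fst_eq, <- !comp_assoc, E1.
  - now rewrite <- transpose_rel_snd_eq, <- !comp_assoc, E2. }
apply pb_ext; [exact E2 | apply pb_ext]; rewrite !comp_assoc;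
  [exact E1 | exact Ep].
Qed.

Lemma related_transpose_relation (T : D) (x y : Hom T B) :
  related transpose_rel_fst transpose_rel_snd x y <->
  related (er_fst S) (er_snd S) (fmap F x) (fmap F y).
Proof.
split.
- intros [u [<- <-]].
  exists (untranspose (transpose_rel_proof ∘ u)).
  rewrite <- !untranspose_comp, !comp_assoc; fold g1 g2.
  rewrite <- transpose_rel_fst_eq, <- transpose_rel_snd_eq, <- !comp_assoc.
  unfold eta; now rewrite <- !transpose_fmap, !untranspose_transpose.
- intros [s [Hx Hy]].
  assert (Ex : eta ∘ x = g1 ∘ transpose s)
    by (unfold eta, g1; now rewrite <- transpose_fmap, <- Hx, transpose_comp).
  assert (Ey : eta ∘ y = g2 ∘ left_snd ∘ pb_lift L Ex).
  { rewrite <- comp_assoc.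
    assert (Es : left_snd ∘ pb_lift L Ex = transpose s) by apply pb_lift_snd.
    rewrite Es; unfold eta, g2; now rewrite <- transpose_fmap, <- Hy, transpose_comp. }
  exists (pb_lift L Ey); split.
  + unfold transpose_rel_fst; rewrite <- comp_assoc, pb_lift_snd.
    apply pb_lift_fst.
  + apply pb_lift_fst.
Qed.

Definition transpose_relation : EquivRel B.
Proof.
refine (@Build_EquivRel D B _ _ _ transpose_rel_monic _ _ _); intros T.
- intros x; apply related_transpose_relation, er_refl.
- intros x y; rewrite !related_transpose_relation; apply er_sym.
- intros x y z; rewrite !related_transpose_relation; apply er_trans.
Defined.

End Relation.
End Transpose.

(** The relation is the largest one on [B] whose image under [F] lies in [S].
    Discrete fibrations over [F m] identify the [S]-class of zero with
    the maps factoring through [F m], and [F] reflects this factorization. *)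
Lemma right_adjoint_reflects_normal_monos {D E : Category} (L : FinitelyComplete D)
  (Z : Pointed D) (F : Functor D E) :
  left_exact F -> conservative F -> has_right_adjoint F -> reflects_normal_monos F.
Proof.
intros HF cF [G [adj]] A B m [Hm [S [N [HN [phi [Hphi Hphi2]]]]]].
assert (mm : monic m) by exact (reflects_monic _ _ L F HF cF m Hm).
split; auto.
exists (transpose_relation _ _ L F G adj B S).
apply (normal_to_zero_class _ L Z); auto.
intros T b; simpl; rewrite related_transpose_relation; split.
- intros [u [u1 u2]].
  destruct (proj2 Hphi _ (fmap F (zero Z T A)) u) as [w [[_ w2] _]].
  { now rewrite u1, <- fmap_comp, comp_zero_r. }
  apply (reflects_factorization _ _ L F HF cF m b (er_snd N ∘ w) Hm).
  now rewrite comp_assoc, (proj1 Hphi2), <- comp_assoc, w2.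
- intros [a ->].
  destruct (HN _ (fmap F (zero Z T A)) (fmap F a)) as [w [[w1 w2] _]].
  exists (phi ∘ w); rewrite !comp_assoc, <- (proj1 Hphi), <- (proj1 Hphi2).
  rewrite <- !comp_assoc, w1, w2, <- !fmap_comp, comp_zero_r; auto.
Qed.

Theorem theorem4p3 (C : Category) (L : FinitelyComplete C)
  (hP : protomodular L)
  (hL : locally_algebraically_cartesian_closed L) :
  strongly_protomodular L.
Proof.
split; auto; intros X Y h; split; [| split].
- apply change_of_base_left_exact.
- apply hP.
- apply right_adjoint_reflects_normal_monos.
  + exact (point_finitely_complete L Y).
  + exact (point_pointed C Y).
  + apply change_of_base_left_exact.
  + apply hP.
  + apply hL.
Qed.
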